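(* Let $\mathbb K$ be a field, $A$ a unitary commutative $\mathbb K$-algebra, $(E'',\cdot_{E''},\theta_{E''})$ a pre-Lie-Rinehart algebra over $A$, and $E'$ an abelian pre-Lie-Rinehart algebra over $A$ (zero product and zero anchor). Let $(\rho,\mu)$ be a representation of $E''$ on the $A$-module $E'$. For a $2$-cocycle $\omega\in\mathrm{Hom}_A(E''\otimes_AE'',E')$, let $E_\omega$ be the abelian extension of $E''$ by $E'$ whose underlying $A$-module is $E''\oplus E'$, with product $$(X+u)\ast(Y+v)=X\cdot_{E''}Y+\omega(X,Y)+\rho(X)(v)+\mu(Y)(u)$$ and anchor $X+u\mapsto\theta_{E''}(X)$, together with the canonical inclusion and projection. Then $\omega\mapsto E_\omega$ induces a one-to-one correspondence between the cohomology classes in $H^2_{\mathrm{PRin}}(E'',E')$ and the equivalence classes of split abelian extensions of $E''$ by $E'$ whose induced representation of $E''$ on $E'$ is $(\rho,\mu)$.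
   Context: $\mathrm{Der}(A)$ is the $A$-module of $\mathbb K$-linear derivations of $A$, with commutator $[-,-]^c$. A pre-Lie $\mathbb K$-algebra is a $\mathbb K$-vector space with a $\mathbb K$-bilinear product whose associator $(x,y,z)=x(yz)-(xy)z$ satisfies $(x,y,z)=(y,x,z)$. A pre-Lie-Rinehart algebra $(E,\cdot_E,\theta_E)$ over $A$ is an $A$-module $E$ with an $A$-module map $\theta_E:E\to\mathrm{Der}(A)$ (the anchor) and a pre-Lie product $\cdot_E$ such that $X\cdot_E(aY)=a(X\cdot_EY)+\theta_E(X)(a)Y$, $(aX)\cdot_EY=a(X\cdot_EY)$ and $\theta_E(X\cdot_EY-Y\cdot_EX)=[\theta_E(X),\theta_E(Y)]^c$. Write $[X,Y]_E=X\cdot_EY-Y\cdot_EX$. A homomorphism of pre-Lie-Rinehart algebras is an $A$-linear map preserving products and anchors. A representation $(\rho,\mu)$ of $E$ on an $A$-module $\mathcal E$ consists of an $A$-linear assignment $X\mapsto\rho(X)\in\mathrm{End}_{\mathbb K}(\mathcal E)$ with $\rho(X)(au)=a\rho(X)u+\theta_E(X)(a)u$ and $\rho([X,Y]_E)=[\rho(X),\rho(Y)]^c$, and an $A$-linear map $\mu:E\to\mathrm{Hom}_A(\mathcal E,\mathcal E)$ with $\rho(X)\mu(Y)-\mu(Y)\rho(X)=\mu(X\cdot_EY)-\mu(Y)\mu(X)$. Cohomology: $C^{n+1}(E,\mathcal E)=\mathrm{Hom}_A(\wedge^nE\otimes E,\mathcal E)$ for $n\ge0$ (exterior and tensor products over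 $A$), and for $\varphi\in C^n(E,\mathcal E)$ $$\begin{aligned}\delta\varphi(X_1,\dots,X_{n+1})=&\sum_{i=1}^n(-1)^{i+1}\rho(X_i)\varphi(X_1,\dots,\widehat{X_i},\dots,X_{n+1})+\sum_{i=1}^n(-1)^{i+1}\mu(X_{n+1})\varphi(X_1,\dots,\widehat{X_i},\dots,X_n,X_i)\\&-\sum_{i=1}^n(-1)^{i+1}\varphi(X_1,\dots,\widehat{X_i},\dots,X_n,X_i\cdot_EX_{n+1})+\sum_{1\le i<j\le n}(-1)^{i+j}\varphi([X_i,X_j]_E,X_1,\dots,\widehat{X_i},\dots,\widehat{X_j},\dots,X_{n+1}).\end{aligned}$$ $H^n_{\mathrm{PRin}}(E,\mathcal E)$ is the $n$-th cohomology of this complex; a $2$-cocycle is $\omega\in C^2$ with $\delta\omega=0$. An abelian extension of $E''$ by $E'$ is a short exact sequence of pre-Lie-Rinehart algebras $0\to E'\xrightarrow{\imath}E\xrightarrow{p}E''\to0$. It is split if there is an $A$-linear $\sigma:E''\to E$ with $p\circ\sigma=\mathrm{id}$. For such $\sigma$, the induced representation is $\rho(X)(u)=\sigma(X)\cdot_Eu$, $\mu(X)(u)=u\cdot_E\sigma(X)$ (independent of $\sigma$ since $E'$ is abelian). Two extensions $E_1,E_2$ are equivalent if there is a homomorphism of pre-Lie-Rinehart algebras $\tau:E_2\to E_1$ with $\tau\circ\imath_2=\imath_1$ and $p_1\circ\tau=p_2$. *)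

(* Defs.v *)
From HB Require Import structures.
From mathcomp Require Import all_boot all_order all_algebra.

Set Implicit Arguments.
Unset Strict Implicit.
Unset Printing Implicit Defensive.

Import GRing.Theory.
Local Open Scope ring_scope.

(* An A-module M is a K-vector space through k |-> k%:A; this is K-linearity
   of maps between A-modules for these K-structures. *)
Definition klinear (K : fieldType) (A : comAlgType K) (M N : lmodType A)
    (f : M -> N) : Prop :=
  forall (k : K) u v, f (k%:A *: u + v) = k%:A *: f u + f v.

Definition derivation (K : fieldType) (A : comAlgType K) (D : A -> A) : Prop :=
  linear D /\ forall a b : A, D (a * b) = a * D b + D a * b.

(* In anchor_mod, the A-module structure of Der(A) is the pointwise one. *)
HB.mixin Record isPreLieRinehart (K : fieldType) (A : comAlgType K) E
    of GRing.Lmodule A E := {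
  plmul : E -> E -> E;
  anchor : E -> A -> A;
  plmul_klinearl : forall Y : E, klinear (fun X : E => plmul X Y);
  plmul_klinearr : forall X : E, klinear (plmul X);
  plmul_assoc_sym : forall X Y Z : E,
    plmul X (plmul Y Z) - plmul (plmul X Y) Z =
    plmul Y (plmul X Z) - plmul (plmul Y X) Z;
  anchor_der : forall X : E, derivation (anchor X);
  anchor_mod : forall (a : A) (X Y : E) (b : A),
    anchor (a *: X + Y) b = a * anchor X b + anchor Y b;
  plmulZr : forall (a : A) (X Y : E),
    plmul X (a *: Y) = a *: plmul X Y + anchor X a *: Y;
  plmulZl : forall (a : A) (X Y : E), plmul (a *: X) Y = a *: plmul X Y;
  anchor_bracket : forall (X Y : E) (b : A),
    anchor (plmul X Y - plmul Y X) b =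
    anchor X (anchor Y b) - anchor Y (anchor X b)
}.

#[short(type="plrType")]
HB.structure Definition PreLieRinehart (K : fieldType) (A : comAlgType K) :=
  {E of isPreLieRinehart K A E & GRing.Lmodule A E}.

Notation "X |> Y" := (plmul X Y) (at level 40, left associativity) : ring_scope.

Section PreLieRinehart.
Variables (K : fieldType) (A : comAlgType K).

Definition plbracket (E : plrType A) (X Y : E) : E := X |> Y - Y |> X.

Definition plr_abelian (E : plrType A) : Prop :=
  (forall X Y : E, X |> Y = 0) /\ (forall (X : E) (a : A), anchor X a = 0).

Definition plr_hom (E F : plrType A) (f : {linear E -> F}) : Prop :=
  (forall X Y : E, f (X |> Y) = f X |> f Y) /\
  (forall (X : E) (a : A), anchor (f X) a = anchor X a).

Record representation (E : plrType A) (M : lmodType A) := Representation {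
  rho : E -> M -> M;
  mu : E -> M -> M;
  rho_klinear : forall X, klinear (rho X);
  rho_linear : forall u, linear (rho^~ u);
  rho_leibniz : forall X a u,
    rho X (a *: u) = a *: rho X u + anchor X a *: u;
  rho_bracket : forall X Y u,
    rho (plbracket X Y) u = rho X (rho Y u) - rho Y (rho X u);
  mu_linear : forall X, linear (mu X);
  mu_linearl : forall u, linear (mu^~ u);
  rho_mu : forall X Y u,
    rho X (mu Y u) - mu Y (rho X u) = mu (X |> Y) u - mu Y (mu X u)
}.

Section Cohomology.
Variables (E : plrType A) (M : lmodType A) (R : representation E M).

(* Functions underlying C^n(E, M) = Hom_A(wedge^(n-1) E (x) E, M), n >= 1:
   the n - 1 arguments of the exterior power are packed in a finite function,
   the last argument is kept apart.  Degree 0, where n.-1 = 0 as well, does not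
   belong to the complex. *)
Definition cochain_fun (n : nat) : Type := {ffun 'I_n.-1 -> E} -> E -> M.

Definition set_arg m (X : {ffun 'I_m -> E}) (i : 'I_m) (Z : E) :
    {ffun 'I_m -> E} :=
  [ffun k => if k == i then Z else X k].

Definition is_cochain n (phi : cochain_fun n) : Prop :=
  [/\ (forall X i Y, linear (fun Z => phi (set_arg X i Z) Y)),
      (forall (X : {ffun 'I_n.-1 -> E}) (i j : 'I_n.-1) Y,
         i != j -> X i = X j -> phi X Y = 0)
    & (forall X, linear (phi X))].

(* X_1, ..., X_n with X_i omitted *)
Definition omit n (X : {ffun 'I_n -> E}) (i : 'I_n) : {ffun 'I_n.-1 -> E} :=
  [ffun k => X (lift i k)].

(* Z, X_1, ..., X_n with X_i and X_j omitted *)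
Definition cons_omit2 n (Z : E) (X : {ffun 'I_n -> E}) (i j : 'I_n) :
    {ffun 'I_n.-1 -> E} :=
  [ffun k : 'I_n.-1 =>
     nth 0 (Z :: [seq X l | l <- enum 'I_n & (l != i) && (l != j)]) k].

(* Indices start at 0, whence the sign (-1)^i where a numbering from 1 gives
   (-1)^(i+1); the parity of i + j is the same in both numberings. *)
Definition delta n (phi : cochain_fun n) : cochain_fun n.+1 :=
  fun (X : {ffun 'I_n -> E}) (Y : E) =>
    \sum_(i < n) (-1) ^+ i *: rho R (X i) (phi (omit X i) Y)
  + \sum_(i < n) (-1) ^+ i *: mu R Y (phi (omit X i) (X i))
  - \sum_(i < n) (-1) ^+ i *: phi (omit X i) (X i |> Y)
  + \sum_(i < n) \sum_(j < n | (i < j)%N)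
      (-1) ^+ (i + j)%N *: phi (cons_omit2 (plbracket (X i) (X j)) X i j) Y.

Definition is_cocycle n (phi : cochain_fun n) : Prop :=
  is_cochain phi /\ forall X Y, delta phi X Y = 0.

(* The complex starts in degree 1, so that the only 1-coboundary is 0. *)
Definition is_coboundary n : cochain_fun n -> Prop :=
  match n with
  | m.+2 => fun phi => exists2 psi : cochain_fun m.+1,
              is_cochain psi & forall X Y, phi X Y = delta psi X Y
  | _ => fun phi => forall X Y, phi X Y = 0
  end.

Record cocycle n := Cocycle {
  cocycle_fun :> cochain_fun n;
  cocycleP : is_cocycle cocycle_fun
}.

Definition cohomologous n (phi psi : cocycle n) : Prop :=
  is_coboundary (fun X Y => cocycle_fun phi X Y - cocycle_fun psi X Y).

End Cohomology.

Record extension (E'' E' : plrType A) := Extension {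
  ext_mid : plrType A;
  ext_inj : {linear E' -> ext_mid};
  ext_proj : {linear ext_mid -> E''};
  ext_inj_hom : plr_hom ext_inj;
  ext_proj_hom : plr_hom ext_proj;
  ext_injective : injective ext_inj;
  ext_exact : forall x, ext_proj x = 0 <-> exists u, x = ext_inj u;
  ext_surjective : forall X, exists x, ext_proj x = X
}.

Definition ext_section (E'' E' : plrType A) (e : extension E'' E')
    (s : {linear E'' -> ext_mid e}) : Prop :=
  forall X, ext_proj e (s X) = X.

(* The representation induced by the section s is R; the products s X |> u
   and u |> s X lie in ker p, identified with E' through ext_inj. *)
Definition induces (E'' E' : plrType A) (e : extension E'' E')
    (s : {linear E'' -> ext_mid e}) (R : representation E'' E') : Prop :=
  forall X u, ext_inj e (rho R X u) = s X |> ext_inj e u /\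
              ext_inj e (mu R X u) = ext_inj e u |> s X.

Definition ext_equiv (E'' E' : plrType A) (e1 e2 : extension E'' E') : Prop :=
  exists2 tau : {linear ext_mid e2 -> ext_mid e1}, plr_hom tau &
    (forall u, tau (ext_inj e2 u) = ext_inj e1 u) /\
    (forall x, ext_proj e1 (tau x) = ext_proj e2 x).

Record split_extension (E'' E' : plrType A) (R : representation E'' E') :=
  SplitExtension {
    split_ext :> extension E'' E';
    split_extP : exists2 s : {linear E'' -> ext_mid split_ext},
      ext_section s & induces s R
  }.

Definition split_equiv (E'' E' : plrType A) (R : representation E'' E')
    (e1 e2 : split_extension R) : Prop :=
  ext_equiv e1 e2.

End PreLieRinehart.

(* A 2-cochain as the A-bilinear map X, Y |-> phi(X; Y), that is, as an element
   of Hom_A(E (x) E, M). *)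
Definition bilin (K : fieldType) (A : comAlgType K) (E : plrType A)
    (M : lmodType A) (phi : cochain_fun E M 2) (X Y : E) : M :=
  phi [ffun=> X] Y.

Section CocycleExtension.
Variables (K : fieldType) (A : comAlgType K) (E'' E' : plrType A).
Variable R : representation E'' E'.

Lemma klinear_of (M N : lmodType A) (f : M -> N) : linear f -> klinear f.
Proof. by move=> lf k u v; rewrite lf. Qed.

Lemma bilin_linearl (phi : cochain_fun E'' E' 2) Y :
  is_cochain phi -> linear (bilin phi ^~ Y).
Proof.
case=> + _ _ => /(_ [ffun=> Y] ord0 Y) h a X Z.
have e T : set_arg [ffun=> Y] ord0 T = [ffun=> T] :> {ffun 'I_2.-1 -> E''}.
  by apply/ffunP=> k; rewrite !ffunE !ord1.
by move: (h a X Z); rewrite !e.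
Qed.

Lemma bilin_linearr (phi : cochain_fun E'' E' 2) X :
  is_cochain phi -> linear (bilin phi X).
Proof. by case=> _ _; apply. Qed.

Lemma delta1E (psi : cochain_fun E'' E' 1) X Y :
  bilin (delta R psi) X Y =
  rho R X (psi [ffun=> 0] Y) + mu R Y (psi [ffun=> 0] X)
    - psi [ffun=> 0] (X |> Y).
Proof.
have e Z : omit [ffun=> Z] ord0 = [ffun=> 0] :> {ffun 'I_1.-1 -> E''}.
  by apply/ffunP=> -[].
rewrite /bilin /delta !big_ord1 big_mkcond big_ord1 /= addr0.
by rewrite !e !ffunE expr0 !scale1r.
Qed.

Lemma delta2E (phi : cochain_fun E'' E' 2) X Y Z :
  delta R phi [ffun k : 'I_2 => if k == ord0 then X else Y] Z =
  rho R X (bilin phi Y Z) - rho R Y (bilin phi X Z)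
  + mu R Z (bilin phi Y X) - mu R Z (bilin phi X Y)
  - bilin phi Y (X |> Z) + bilin phi X (Y |> Z)
  - bilin phi (plbracket X Y) Z.
Proof.
set W := [ffun k => _].
have W0 : W ord0 = X by rewrite ffunE.
have W1 : W (lift ord0 ord0) = Y by rewrite ffunE.
have e0 : omit W ord0 = [ffun=> Y] :> {ffun 'I_2.-1 -> E''}.
  by apply/ffunP=> k; rewrite !ffunE.
have e1 : omit W (lift ord0 ord0) = [ffun=> X] :> {ffun 'I_2.-1 -> E''}.
  by apply/ffunP=> k; rewrite !ffunE (ord1 (k : 'I_1)).
have e2 T : cons_omit2 T W ord0 (lift ord0 ord0) = [ffun=> T]
    :> {ffun 'I_2.-1 -> E''}.
  by apply/ffunP=> k; rewrite !ffunE (ord1 (k : 'I_1)).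
rewrite /delta !big_ord_recl !big_ord0 !addr0 /=.
do 2 rewrite big_mkcond !big_ord_recl big_ord0 /=.
rewrite !W0 !W1 !e0 !e1 !e2 -/(bilin phi _ _) !addr0 !add0r !expr0 !expr1.
by rewrite !scale1r !scaleN1r opprD opprK !addrA.
Qed.

(* The module E'' (+) E', under a name that depends on w, since the product
   declared on it does. *)
Definition twisted (w : cocycle R 2) : Type := (E'' * E')%type.

Section Twisted.
Variable w : cocycle R 2.

HB.instance Definition _ := GRing.Lmodule.on (twisted w).

Definition tw_mul (x y : twisted w) : twisted w :=
  (x.1 |> y.1, bilin (cocycle_fun w) x.1 y.1 + rho R x.1 y.2 + mu R y.1 x.2).

Definition tw_anchor (x : twisted w) (a : A) : A := anchor x.1 a.

Let wc : is_cochain (cocycle_fun w) := (cocycleP w).1.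

Lemma tw_addrAC (V : zmodType) (a b c d e f g h i j : V) :
  (a + (b + c + d) + e) - (f + g + (h + i + j)) =
  (a + b - f - h) + (c - g) + (d - i) + (e - j).
Proof. by rewrite !opprD !addrA [LHS](ACl (1*2*6*8*3*7*4*9*5*10)). Qed.

Lemma plmul_linearl (E : plrType A) (Y : E) : linear (fun X : E => X |> Y).
Proof.
by move=> a X Z; have := plmul_klinearl Y 1 (a *: X) Z; rewrite !scale1r plmulZl.
Qed.

Lemma plmulDr (E : plrType A) (X Y Z : E) : X |> (Y + Z) = X |> Y + X |> Z.
Proof. by have := plmul_klinearr X 1 Y Z; rewrite !scale1r. Qed.

Lemma rhoD X u v : rho R X (u + v) = rho R X u + rho R X v.
Proof. by have := rho_klinear R X 1 u v; rewrite !scale1r. Qed.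

Lemma muD X u v : mu R X (u + v) = mu R X u + mu R X v.
Proof. by have := mu_linear R X 1 u v; rewrite !scale1r. Qed.

Lemma tw_mul_linearl (Y : twisted w) : linear (tw_mul^~ Y).
Proof.
move=> a X Z; congr pair => /=; first by rewrite plmul_linearl.
rewrite (bilin_linearl _ wc) (rho_linear R) (mu_linear R) !scalerDr !addrA.
by rewrite [LHS](ACl (1*3*5*2*4*6)).
Qed.

Lemma tw_mulDr (X Y Z : twisted w) : tw_mul X (Y + Z) = tw_mul X Y + tw_mul X Z.
Proof.
congr pair => /=; first exact: plmulDr.
have:= bilin_linearr X.1 wc 1 Y.1 Z.1; have:= mu_linearl R X.2 1 Y.1 Z.1.
rewrite rhoD !scale1r => -> ->.
by rewrite !addrA [LHS](ACl (1*3*5*2*4*6)).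
Qed.

Lemma tw_mulZr (a : A) (X Y : twisted w) :
  tw_mul X (a *: Y) = a *: tw_mul X Y + tw_anchor X a *: Y.
Proof.
congr pair => /=; first exact: plmulZr.
have b0 : bilin (cocycle_fun w) X.1 0 = 0.
  by have := bilin_linearr X.1 wc (-1) 0 0; rewrite !scaler0 addr0 scaleN1r addNr.
have m0 : mu R 0 X.2 = 0.
  by have := mu_linearl R X.2 (-1) 0 0; rewrite !scaler0 addr0 scaleN1r addNr.
have:= bilin_linearr X.1 wc a Y.1 0; have:= mu_linearl R X.2 a Y.1 0.
rewrite !addr0 b0 m0 !addr0 rho_leibniz => -> ->.
by rewrite !scalerDr !addrA [LHS](ACl (1*2*4*3)).
Qed.

Lemma tw_mulZl (a : A) (X Y : twisted w) : tw_mul (a *: X) Y = a *: tw_mul X Y.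
Proof.
have t0 : tw_mul 0 Y = 0.
  by have := tw_mul_linearl Y (-1) 0 0; rewrite !scaler0 addr0 scaleN1r addNr.
by have := tw_mul_linearl Y a X 0; rewrite t0 !addr0.
Qed.

Lemma tw_mul_klinearl (Y : twisted w) : klinear (tw_mul^~ Y).
Proof. by move=> k u v; rewrite tw_mul_linearl. Qed.

Lemma anchor_scalar (E : plrType A) (X : E) (k : K) : anchor X k%:A = 0.
Proof.
have [lD LD] := anchor_der X.
have D1 : anchor X 1 = 0.
  have := LD 1 1; rewrite !mulr1 mul1r => /esym/eqP.
  by rewrite -subr_eq0 addrK => /eqP.
have D0 : anchor X 0 = 0.
  by have := lD (-1) 0 0; rewrite !scaler0 addr0 scaleN1r addNr.
by have := lD k 1 0; rewrite !addr0 D0 D1 addr0 scaler0.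
Qed.

Lemma tw_mul_klinearr (X : twisted w) : klinear (tw_mul X).
Proof.
by move=> k u v; rewrite tw_mulDr tw_mulZr /tw_anchor anchor_scalar scale0r addr0.
Qed.

Lemma tw_assoc_sym (X Y Z : twisted w) :
  tw_mul X (tw_mul Y Z) - tw_mul (tw_mul X Y) Z =
  tw_mul Y (tw_mul X Z) - tw_mul (tw_mul Y X) Z.
Proof.
case: X Y Z => [X u] [Y v] [Z t]; congr pair => /=.
  exact: plmul_assoc_sym.
rewrite !rhoD !muD !tw_addrAC.
have -> : rho R X (rho R Y t) - rho R (X |> Y) t =
          rho R Y (rho R X t) - rho R (Y |> X) t.
  have := rho_linear R t (-1) (Y |> X) (X |> Y).
  rewrite scaleN1r [- (Y |> X) + _]addrC -/(plbracket X Y) rho_bracket scaleN1r => /eqP.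
  by rewrite subr_eq => /eqP ->; rewrite [LHS](ACl (3*1*2*4)) /= addrK.
rewrite !rho_mu.
have -> : bilin (cocycle_fun w) X (Y |> Z) + rho R X (bilin (cocycle_fun w) Y Z)
   - bilin (cocycle_fun w) (X |> Y) Z - mu R Z (bilin (cocycle_fun w) X Y)
  = bilin (cocycle_fun w) Y (X |> Z) + rho R Y (bilin (cocycle_fun w) X Z)
   - bilin (cocycle_fun w) (Y |> X) Z - mu R Z (bilin (cocycle_fun w) Y X).
  have := (cocycleP w).2 [ffun k : 'I_2 => if k == ord0 then X else Y] Z.
  rewrite delta2E.
  have := bilin_linearl Z wc (-1) (Y |> X) (X |> Y).
  rewrite scaleN1r [- (Y |> X) + _]addrC -/(plbracket X Y) scaleN1r => -> e.
  apply/eqP; rewrite -subr_eq0 -e; apply/eqP.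
  by rewrite !opprD !opprK !addrA [LHS](ACl (2*6*8*4*5*1*7*3)).
by rewrite addrAC.
Qed.

Lemma tw_anchor_der (X : twisted w) : derivation (tw_anchor X).
Proof. exact: anchor_der. Qed.

Lemma tw_anchor_mod (a : A) (X Y : twisted w) (b : A) :
  tw_anchor (a *: X + Y) b = a * tw_anchor X b + tw_anchor Y b.
Proof. exact: anchor_mod. Qed.

Lemma tw_anchor_bracket (X Y : twisted w) (b : A) :
  tw_anchor (tw_mul X Y - tw_mul Y X) b =
  tw_anchor X (tw_anchor Y b) - tw_anchor Y (tw_anchor X b).
Proof. exact: anchor_bracket. Qed.

HB.instance Definition _ := isPreLieRinehart.Build K A (twisted w)
  tw_mul_klinearl tw_mul_klinearr tw_assoc_sym tw_anchor_der tw_anchor_mod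
  tw_mulZr tw_mulZl tw_anchor_bracket.

Definition tw_inj (u : E') : twisted w := (0, u).
Definition tw_proj (x : twisted w) : E'' := x.1.
Definition tw_sec (X : E'') : twisted w := (X, 0).

Lemma tw_inj_linear : linear tw_inj.
Proof. by move=> a u v; congr pair; rewrite /= scaler0 addr0. Qed.
Lemma tw_proj_linear : linear tw_proj.
Proof. by []. Qed.
Lemma tw_sec_linear : linear tw_sec.
Proof. by move=> a u v; congr pair; rewrite /= scaler0 addr0. Qed.

HB.instance Definition _ := GRing.isLinear.Build A E' (twisted w) *:%R tw_inj
  tw_inj_linear.
HB.instance Definition _ := GRing.isLinear.Build A (twisted w) E'' *:%R tw_proj
  tw_proj_linear.
HB.instance Definition _ := GRing.isLinear.Build A E'' (twisted w) *:%R tw_sec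
  tw_sec_linear.

Hypothesis abE' : plr_abelian E'.

Lemma bilin0l Y : bilin (cocycle_fun w) 0 Y = 0.
Proof.
by have := bilin_linearl Y wc (-1) 0 0; rewrite !scaler0 addr0 scaleN1r addNr.
Qed.
Lemma bilin0r X : bilin (cocycle_fun w) X 0 = 0.
Proof.
by have := bilin_linearr X wc (-1) 0 0; rewrite !scaler0 addr0 scaleN1r addNr.
Qed.
Lemma rho0l u : rho R 0 u = 0.
Proof.
by have := rho_linear R u (-1) 0 0; rewrite !scaler0 addr0 scaleN1r addNr.
Qed.
Lemma rho0r X : rho R X 0 = 0.
Proof. by have := rho_leibniz R X 0 0; rewrite !scale0r scaler0 addr0. Qed.
Lemma mu0l u : mu R 0 u = 0.
Proof.
by have := mu_linearl R u (-1) 0 0; rewrite !scaler0 addr0 scaleN1r addNr.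
Qed.
Lemma mu0r X : mu R X 0 = 0.
Proof.
by have := mu_linear R X (-1) 0 0; rewrite !scaler0 addr0 scaleN1r addNr.
Qed.
Lemma plmul0l (E : plrType A) (Y : E) : 0 |> Y = 0.
Proof.
by have := plmul_linearl Y (-1) 0 0; rewrite !scaler0 addr0 scaleN1r addNr.
Qed.
Lemma plmul0r (E : plrType A) (X : E) : X |> 0 = 0.
Proof.
have := plmulDr X 0 0; rewrite addr0 => /esym/eqP.
by rewrite -subr_eq0 addrK => /eqP.
Qed.
Lemma anchor0 (E : plrType A) (b : A) : anchor (0 : E) b = 0.
Proof.
by have := anchor_mod (-1) (0 : E) 0 b; rewrite scaler0 addr0 mulN1r addNr.
Qed.

Lemma tw_inj_hom : plr_hom tw_inj.
Proof.
split=> [u v|u a]; last by rewrite abE'.2 /anchor /= /tw_anchor anchor0.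
by congr pair; rewrite /= ?plmul0l // bilin0l rho0l mu0l abE'.1 !addr0.
Qed.

Lemma tw_proj_hom : plr_hom tw_proj.
Proof. by []. Qed.

Lemma tw_inj_injective : injective tw_inj.
Proof. by move=> u v []. Qed.

Lemma tw_exact x : tw_proj x = 0 <-> exists u, x = tw_inj u.
Proof.
split=> [x0|[u ->] //]; exists x.2.
by rewrite /tw_inj -x0; case: x {x0}.
Qed.

Lemma tw_surjective X : exists x, tw_proj x = X.
Proof. by exists (tw_sec X). Qed.

Definition cocycle_ext : extension E'' E' :=
  Extension tw_inj_hom tw_proj_hom tw_inj_injective tw_exact tw_surjective.

Lemma cocycle_extP :
  exists2 s : {linear E'' -> ext_mid cocycle_ext}, ext_section s & induces s R.
Proof.
exists tw_sec => // X u; split; congr pair => /=.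
- by rewrite plmul0r.
- by rewrite bilin0r mu0l add0r addr0.
- by rewrite plmul0l.
- by rewrite bilin0l rho0l !add0r.
Qed.

Definition cocycle_split_ext : split_extension R := SplitExtension cocycle_extP.

End Twisted.
End CocycleExtension.

Section Equivalences.
Variables (K : fieldType) (A : comAlgType K).

Lemma is_cochain0 n (E : plrType A) (M : lmodType A) :
  @is_cochain K A E M n (fun _ _ => 0).
Proof. by split=> [X i Y|X i j|X] // a u v; rewrite scaler0 addr0. Qed.

Lemma is_cochainB n (E : plrType A) (M : lmodType A)
    (phi psi : cochain_fun E M n) :
  is_cochain phi -> is_cochain psi -> is_cochain (fun X Y => phi X Y - psi X Y).
Proof.
move=> [lp ap rp] [ls as_ rs]; split=> [X i Y a u v|X i j Y ij Xij|X a u v].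
- by rewrite lp ls scalerBr opprD addrACA.
- by rewrite (ap _ i j) // (as_ _ i j) // subr0.
- by rewrite rp rs scalerBr opprD addrACA.
Qed.

Lemma deltaB n (E : plrType A) (M : lmodType A) (R : representation E M)
    (phi psi : cochain_fun E M n) X Y :
  delta R (fun X Y => phi X Y - psi X Y) X Y =
  delta R phi X Y - delta R psi X Y.
Proof.
have kB f : klinear f -> forall u v : M, f (u - v) = f u - f v :> M.
  move=> lf u v; have := lf (-1) v u; rewrite !scaleN1r addrC => ->.
  by rewrite addrC.
have rB Z := kB _ (rho_klinear R Z).
have mB Z := kB _ (klinear_of (mu_linear R Z)).
rewrite /delta.
under eq_bigr do rewrite rB scalerBr.
rewrite sumrB; under [X in _ + X - _ + _]eq_bigr do rewrite mB scalerBr.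
rewrite sumrB; under [X in _ - X + _]eq_bigr do rewrite scalerBr.
rewrite sumrB; under [X in _ + X = _]eq_bigr => i _.
  under eq_bigr do rewrite scalerBr.
  rewrite sumrB; over.
rewrite sumrB !opprD !opprK !addrA.
by rewrite [LHS](ACl (1*3*5*7*2*4*6*8)).
Qed.

Lemma is_coboundary0 n (E : plrType A) (M : lmodType A)
    (R : representation E M) : @is_coboundary K A E M R n (fun _ _ => 0).
Proof.
case: n => [|[|m]] //; exists (fun _ _ => 0 - 0).
  by apply: is_cochainB; apply: is_cochain0.
by move=> X Y; rewrite deltaB subrr.
Qed.

Lemma is_coboundaryB n (E : plrType A) (M : lmodType A)
    (R : representation E M) (phi psi : cochain_fun E M n) :
  is_coboundary R phi -> is_coboundary R psi ->
  is_coboundary R (fun X Y => phi X Y - psi X Y).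
Proof.
case: n phi psi => [|[|m]] phi psi.
- by move=> h h' X Y; rewrite h h' subrr.
- by move=> h h' X Y; rewrite h h' subrr.
move=> [p pc ph] [q qc qh]; exists (fun X Y => p X Y - q X Y).
  exact: is_cochainB.
by move=> X Y; rewrite deltaB ph qh.
Qed.

Lemma is_coboundary_ext n (E : plrType A) (M : lmodType A)
    (R : representation E M) (phi psi : cochain_fun E M n) :
  (forall X Y, phi X Y = psi X Y) -> is_coboundary R phi ->
  is_coboundary R psi.
Proof.
case: n phi psi => [|[|m]] phi psi e.
- by move=> h X Y; rewrite -e.
- by move=> h X Y; rewrite -e.
by move=> [p pc ph]; exists p => // X Y; rewrite -e.
Qed.

Lemma cohomologous_refl n (E : plrType A) (M : lmodType A)
    (R : representation E M) (phi : cocycle R n) : cohomologous phi phi.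
Proof.
by apply: is_coboundary_ext (is_coboundary0 n R) => X Y; rewrite subrr.
Qed.

Lemma cohomologous_sym n (E : plrType A) (M : lmodType A)
    (R : representation E M) (phi psi : cocycle R n) :
  cohomologous phi psi -> cohomologous psi phi.
Proof.
move/(is_coboundaryB (is_coboundary0 n R)).
by apply: is_coboundary_ext => X Y; rewrite sub0r opprB.
Qed.

Lemma cohomologous_trans n (E : plrType A) (M : lmodType A)
    (R : representation E M) (phi psi chi : cocycle R n) :
  cohomologous phi psi -> cohomologous psi chi -> cohomologous phi chi.
Proof.
move=> pp /cohomologous_sym pc; move: (is_coboundaryB pp pc).
by apply: is_coboundary_ext => X Y; rewrite opprB addrA subrK.
Qed.

Lemma ext_equiv_refl (E'' E' : plrType A) (e : extension E'' E') :
  ext_equiv e e.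
Proof. by exists idfun. Qed.

Lemma ext_equiv_trans (E'' E' : plrType A) (e1 e2 e3 : extension E'' E') :
  ext_equiv e1 e2 -> ext_equiv e2 e3 -> ext_equiv e1 e3.
Proof.
move=> [t [tM tA] [ti tp]] [t' [tM' tA'] [ti' tp']].
exists (t \o t').
  by split=> [X Y|X a] /=; rewrite ?tM' ?tM ?tA ?tA'.
by split=> x /=; rewrite ?ti' ?ti ?tp ?tp'.
Qed.

Lemma ext_equiv_sym (E'' E' : plrType A) (e1 e2 : extension E'' E') :
  ext_equiv e1 e2 -> ext_equiv e2 e1.
Proof.
move=> [t [tM tA] [ti tp]].
have tI : injective t.
  move=> x y /eqP; rewrite -subr_eq0 -linearB /= => /eqP e.
  have /ext_exact[u xy] : ext_proj e2 (x - y) = 0 by rewrite -tp e linear0.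
  move: e; rewrite xy ti -(linear0 (ext_inj e1)) => /ext_injective u0.
  by apply/eqP; rewrite -subr_eq0 xy u0 linear0.
have tS y : exists x, t x == y.
  have [x xy] := ext_surjective e2 (ext_proj e1 y).
  have /ext_exact[u yx] : ext_proj e1 (y - t x) = 0.
    by rewrite linearB /= tp xy subrr.
  by exists (x + ext_inj e2 u); rewrite linearD /= ti -yx addrC subrK.
pose g y := xchoose (tS y).
have gK y : t (g y) = y by apply/eqP/(xchooseP (tS y)).
have gL : linear g by move=> a x y; apply: tI; rewrite linearP !gK.
pose G : {linear _ -> _} :=
  HB.pack g (GRing.isLinear.Build A (ext_mid e1) (ext_mid e2) *:%R g gL).
exists G; split=> /=.
- by move=> X Y; apply: tI; rewrite tM !gK.
- by move=> X a; rewrite -tA gK.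
- by move=> u; apply: tI; rewrite gK ti.
- by move=> x; rewrite -tp gK.
Qed.

End Equivalences.

(* The set of classes of T modulo r, as predicates on T.  The two relations used
   below are equivalence relations: see cohomologous_{refl,sym,trans} and
   ext_equiv_{refl,sym,trans}. *)
Definition quotient (T : Type) (r : T -> T -> Prop) : Type :=
  {C : T -> Prop | exists x, C = r x}.

Definition class_of (T : Type) (r : T -> T -> Prop) (x : T) : quotient r :=
  exist _ (r x) (ex_intro _ x erefl).

Definition cohomology (K : fieldType) (A : comAlgType K) (E : plrType A)
    (M : lmodType A) (R : representation E M) (n : nat) : Type :=
  quotient (@cohomologous K A E M R n).

Definition ext_classes (K : fieldType) (A : comAlgType K) (E'' E' : plrType A)
    (R : representation E'' E') : Type :=
  quotient (@split_equiv K A E'' E' R).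

(* Main.v *)
From HB Require Import structures.
Require Import Defs.
From mathcomp Require Import all_boot all_order all_algebra.
From mathcomp Require Import boolp.

Set Implicit Arguments.
Unset Strict Implicit.
Unset Printing Implicit Defensive.

Import GRing.Theory.
Local Open Scope ring_scope.

(** A linear section s of a split extension e of E'' by E' need not preserve
    products; its failure to do so, the curvature
      (X, Y) |-> s X |> s Y - s (X |> Y),
    takes its values in the kernel of the projection, that is, in E'.

    The curvature determines e.  Every element of the middle algebra is uniquely
    s X + u with u in E'; products with one factor in E' are given by the
    induced representation, products inside E' vanish, and the product of s X
    and s Y is s (X |> Y) plus the curvature.  So e is equivalent to the
    extension built from a cocycle w exactly when w is the curvature of some
    linear section of e ([ext_equiv_cocycle_ext]).  Conversely every curvature
    is a 2-cocycle ([section_cocycle]): applying the cocycle operator to it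
    compares the associator of the s X with the image under s of the associator
    in E'', and both are symmetric in their first two arguments.  Together these
    say that every split extension comes from some cocycle.

    It remains to see when two cocycles w and w' give equivalent extensions.
    By the same criterion, this happens when w' is the curvature of a section of
    the extension built from w.  Such a section has the form X |-> X + psi X
    with psi a 1-cochain, and its curvature is w + delta psi, whence w' is
    cohomologous to w ([cohomologous_curvature]).  The bijection between sets of
    classes then follows formally ([quotient_bijection]). *)

(** Classes are predicates, so a class of T is sent to the union of the classes
    of the images of its elements, and a class of U to its preimage under F.
    Both directions are explicit, and no representative has to be chosen. *)
Lemma quotient_bijection (T U : Type) (r : T -> T -> Prop) (s : U -> U -> Prop)
    (F : T -> U) :
  (forall u, s u u) -> (forall u v, s u v -> s v u) ->
  (forall u v t, s u v -> s v t -> s u t) ->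
  (forall x y, r x y <-> s (F x) (F y)) -> (forall u, exists x, s u (F x)) ->
  exists2 Phi : quotient r -> quotient s,
    bijective Phi & forall x, Phi (class_of r x) = class_of s (F x).
Proof.
move=> srefl ssym strans rs Fsurj.
have rrefl x : r x x by apply/rs.
have s_eq u v : s u v -> s u = s v.
  move=> uv; apply/funext => t; apply/propext; split; last exact: strans.
  by apply: strans; apply: ssym.
pose img (C : T -> Prop) u := exists2 x, C x & s (F x) u.
have img_class x : img (r x) = s (F x).
  apply/funext => u; apply/propext; split=> [[y /rs xy]|]; last by exists x.
  exact: strans.
pose preim (D : U -> Prop) x := D (F x).
have preim_class x : preim (s (F x)) = r x.
  by apply/funext => y; apply/propext; split => /rs.
have img_quotient (C : quotient r) : exists u, img (sval C) = s u.
  by case: C => C [x Cx]; exists (F x); rewrite /= Cx img_class.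
have preim_quotient (D : quotient s) : exists x, preim (sval D) = r x.
  case: D => D [u Du]; have [x ux] := Fsurj u.
  by exists x => /=; rewrite Du (s_eq _ _ ux) preim_class.
exists (fun C => exist _ (img (sval C)) (img_quotient C)) => [|x].
  exists (fun D => exist _ (preim (sval D)) (preim_quotient D)).
    by case=> C [x Cx]; apply: eq_exist; rewrite /= Cx img_class preim_class.
  case=> D [u Du]; apply: eq_exist => /=; have [x ux] := Fsurj u.
  by rewrite Du (s_eq _ _ ux) preim_class img_class.
by apply: eq_exist; exact: img_class.
Qed.

Section Extension.
Variables (K : fieldType) (A : comAlgType K) (E'' E' : plrType A).
Implicit Types e : extension E'' E'.

Lemma plmulDl (E : plrType A) (X Y Z : E) : (X + Y) |> Z = X |> Z + Y |> Z.
Proof. by have := plmul_linearl Z 1 X Y; rewrite !scale1r. Qed.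

Lemma plmulBl (E : plrType A) (X Y Z : E) : (X - Y) |> Z = X |> Z - Y |> Z.
Proof. by apply/eqP; rewrite eq_sym subr_eq -plmulDl subrK. Qed.

Lemma plmulBr (E : plrType A) (X Y Z : E) : X |> (Y - Z) = X |> Y - X |> Z.
Proof. by apply/eqP; rewrite eq_sym subr_eq -plmulDr subrK. Qed.

Lemma bilinBl (phi : cochain_fun E'' E' 2) X Y Z :
  is_cochain phi -> bilin phi (X - Y) Z = bilin phi X Z - bilin phi Y Z.
Proof.
move=> phi_cochain; have := bilin_linearl Z phi_cochain (-1) Y X.
by rewrite !scaleN1r [- Y + X]addrC => ->; rewrite addrC.
Qed.

(** Functions into the kernel of the projection are functions into E'. *)
Lemma ext_ker_lift e (S : Type) (f : S -> ext_mid e) :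
  (forall x, ext_proj e (f x) = 0) ->
  exists g : S -> E', forall x, ext_inj e (g x) = f x.
Proof.
move=> f0; have fi x : exists u, ext_inj e u == f x.
  by have /ext_exact[u ->] := f0 x; exists u.
by exists (fun x => xchoose (fi x)) => x; apply/eqP/(xchooseP (fi x)).
Qed.

Definition curvature e (s : E'' -> ext_mid e) (X Y : E'') : ext_mid e :=
  s X |> s Y - s (X |> Y).

Section SectionCurvature.
Variables (e : extension E'' E') (s : {linear E'' -> ext_mid e}).
Hypothesis sec_s : ext_section s.

Lemma ext_proj_curvature X Y : ext_proj e (curvature s X Y) = 0.
Proof. by rewrite linearB (ext_proj_hom e).1 !sec_s subrr. Qed.

Lemma section_anchor X a : anchor (s X) a = anchor X a.
Proof. by rewrite -(ext_proj_hom e).2 sec_s. Qed.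

Lemma curvature_linearl Y : linear (curvature s ^~ Y).
Proof.
move=> a X Z; rewrite /curvature linearP !plmulDl !plmulZl linearP scalerBr.
by rewrite opprD addrACA.
Qed.

(** Both s X |> s (a *: Y) and s (X |> (a *: Y)) contribute a Leibniz term; the
    two cancel because s, being a section of a homomorphism, preserves anchors. *)
Lemma curvature_linearr X : linear (curvature s X).
Proof.
move=> a Y Z; rewrite /curvature linearP !plmulDr !plmulZr section_anchor.
rewrite [s (_ + _ + _)]linearD [s (_ + _)]linearP [s (_ *: _)]linearZ /=.
rewrite scalerBr.
rewrite !opprD !addrA.
by rewrite [LHS](ACl (1*4*3*6*2*5)) /= addrK.
Qed.

End SectionCurvature.
Section InducedRepresentation.
Variables (R : representation E'' E') (e : extension E'' E').
Variable s : {linear E'' -> ext_mid e}.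
Hypotheses (sec_s : ext_section s) (ind_s : induces s R).

(** The left-hand side is one half of the cocycle operator: delta w (X, Y; Z) is
    this expression minus the one with X and Y exchanged.  Expanding the
    curvatures, the mixed terms s X |> s (Y |> Z) and s (X |> Y) |> s Z cancel,
    and only associators remain. *)
Lemma curvature_associator (w : E'' -> E'' -> E') X Y Z :
  (forall X Y, ext_inj e (w X Y) = curvature s X Y) ->
  ext_inj e (rho R X (w Y Z) - mu R Z (w X Y) + w X (Y |> Z) - w (X |> Y) Z) =
  (s X |> (s Y |> s Z) - (s X |> s Y) |> s Z) -
  s (X |> (Y |> Z) - (X |> Y) |> Z).
Proof.
move=> wE; rewrite !(linearB, linearD) /= (ind_s X _).1 (ind_s Z _).2 !wE.
rewrite /curvature plmulBl plmulBr !opprD !opprK !addrA.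
by rewrite [LHS](ACl (1*3*6*8*2*5*4*7)) /= addrNK addrK.
Qed.

(** The cocycle condition holds since, by [curvature_associator], each half of
    delta w is a difference of associators, hence symmetric in its first two
    arguments. *)
Lemma section_cocycle :
  exists w : cocycle R 2,
    forall X Y, ext_inj e (bilin (cocycle_fun w) X Y) = curvature s X Y.
Proof.
have [g gE] := @ext_ker_lift e _ (fun p => curvature s p.1 p.2)
  (fun p => ext_proj_curvature sec_s p.1 p.2).
pose w : cochain_fun E'' E' 2 := fun X Y => g (X ord0, Y).
have wE X Y : ext_inj e (bilin w X Y) = curvature s X Y.
  by rewrite /bilin /w gE /= ffunE.
have w_cochain : is_cochain w.
  split=> [X i Y a u v|X i j Y|X a u v].
  - apply: (@ext_injective _ _ _ _ e); rewrite linearP /w !gE /= !ffunE !ord1 /=.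
    exact: curvature_linearl.
  - by rewrite !ord1.
  - apply: (@ext_injective _ _ _ _ e); rewrite linearP /w !gE /=.
    exact: curvature_linearr.
suff w_cocycle : is_cocycle R w by exists (Cocycle w_cocycle).
split=> // X Z; set X1 := X ord0; set X2 := X (lift ord0 ord0).
have -> : X = [ffun k : 'I_2 => if k == ord0 then X1 else X2].
  apply/ffunP => k; rewrite ffunE; case: eqP => [->//|/eqP k0].
  by congr (X _); apply/val_inj; case: k k0 => [[|[|]]].
rewrite delta2E bilinBl //.
apply: (@ext_injective _ _ _ _ e); rewrite linear0.
have := curvature_associator X1 X2 Z wE.
rewrite plmul_assoc_sym [X in _ - s X]plmul_assoc_sym.
rewrite -(curvature_associator X2 X1 Z wE) => /eqP.
rewrite -subr_eq0 -linearB => /eqP <-; congr (ext_inj e _).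
by rewrite !opprD !opprK !addrA [LHS](ACl (1*4*6*7*2*3*5*8)).
Qed.

End InducedRepresentation.

Section Abelian.
Hypothesis abE' : plr_abelian E'.
Variable R : representation E'' E'.

(** Two sections differ by elements of E', whose products with E' vanish. *)
Lemma induces_section e (s s' : {linear E'' -> ext_mid e}) :
  ext_section s -> ext_section s' -> induces s R -> induces s' R.
Proof.
move=> sec_s sec_s' ind_s X u; have [-> ->] := ind_s X u.
have /ext_exact[v s'E] : ext_proj e (s' X - s X) = 0.
  by rewrite linearB sec_s sec_s' subrr.
have -> : s' X = ext_inj e v + s X by rewrite -s'E subrK.
by rewrite plmulDl plmulDr -!(ext_inj_hom e).1 !abE'.1 linear0 !add0r.
Qed.

(** An equivalence carries the canonical section X |-> (X, 0), whose curvature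
    is w, to a section of e with the same curvature.  In the other direction the
    equivalence is (X, u) |-> s X + u: knowing the curvature of s and the
    induced representation is knowing the whole product of e. *)
Lemma ext_equiv_cocycle_ext (e : split_extension R) (w : cocycle R 2) :
  ext_equiv e (cocycle_ext w abE') <->
  exists2 s : {linear E'' -> ext_mid e}, ext_section s &
    forall X Y, ext_inj e (bilin (cocycle_fun w) X Y) = curvature s X Y.
Proof.
split=> [[tau [tauM _] [tau_inj tau_proj]] | [s sec_s wE]].
  exists (tau \o tw_sec w) => [X|X Y] /=; first by rewrite tau_proj.
  rewrite /curvature /= -tauM -linearB -tau_inj; congr (tau _).
  by congr pair; rewrite /= ?subrr // rho0r mu0r !addr0 subr0.
have [s0 sec_s0 ind_s0] := split_extP e.
have ind_s := induces_section sec_s0 sec_s ind_s0.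
pose f (x : twisted w) : ext_mid e := s x.1 + ext_inj e x.2.
have f_linear : linear f.
  by move=> a x y; rewrite /f !linearP scalerDr addrACA.
pose tau : {linear _ -> _} :=
  HB.pack f (GRing.isLinear.Build A (twisted w) (ext_mid e) *:%R f f_linear).
exists tau; split=> /=.
- move=> [X u] [Y v]; rewrite /f /= !linearD /= wE (ind_s X v).1 (ind_s Y u).2.
  rewrite /curvature plmulDl !plmulDr -(ext_inj_hom e).1 abE'.1 linear0 addr0.
  by rewrite !addrA [s _ + _]addrC addrK.
- move=> [X u] a; rewrite -[f _]/(s X + ext_inj e u).
  have := anchor_mod 1 (s X) (ext_inj e u) a; rewrite scale1r mul1r => ->.
  by rewrite (ext_inj_hom e).2 abE'.2 addr0 section_anchor.
- by move=> u; rewrite /f linear0 add0r.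
- move=> [X u]; rewrite /f linearD sec_s.
  have -> : ext_proj e (ext_inj e u) = 0 by apply/ext_exact; exists u.
  exact: addr0.
Qed.

(** The linear sections of the extension built from w are the graphs of the
    linear maps psi from E'' to E', and moving from the canonical section to the
    graph of psi changes the curvature from w to w + delta psi. *)
Lemma cohomologous_curvature (w w' : cocycle R 2) :
  cohomologous w' w <->
  exists2 s : {linear E'' -> ext_mid (cocycle_ext w abE')}, ext_section s &
    forall X Y, ext_inj (cocycle_ext w abE') (bilin (cocycle_fun w') X Y) =
      curvature s X Y.
Proof.
have curvE (s : E'' -> ext_mid (cocycle_ext w abE'))
    (psi : cochain_fun E'' E' 1) X Y :
    (forall X, s X = (X, psi [ffun=> 0] X)) ->
    curvature s X Y =
    ext_inj (cocycle_ext w abE')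
      (bilin (cocycle_fun w) X Y + bilin (delta R psi) X Y).
  move=> sE; rewrite /curvature !sE; congr pair => /=; first by rewrite subrr.
  by rewrite delta1E !addrA.
split=> [[psi psi_cochain w'E] | [s sec_s w'E]].
  pose f X : twisted w := (X, psi [ffun=> 0] X).
  have f_linear : linear f.
    by move=> a X Y; rewrite /f; case: psi_cochain => _ _ ->.
  pose s : {linear _ -> _} :=
    HB.pack f (GRing.isLinear.Build A E'' (twisted w) *:%R f f_linear).
  exists s => //.
  move=> X Y; rewrite (curvE _ psi) // /bilin -w'E.
  by rewrite addrC subrK.
pose psi : cochain_fun E'' E' 1 := fun _ X => (s X).2.
exists psi.
  split=> [X []|X []|X a Y Z] //.
  by rewrite /psi linearP.
move=> X Y; have {1 2 3}-> : X = [ffun=> X ord0].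
  by apply/ffunP=> i; rewrite ffunE ord1.
have := w'E (X ord0) Y; rewrite (curvE _ psi) => [|Z].
  by move/ext_injective; rewrite /bilin => ->; rewrite addrC addKr.
by rewrite /psi -{2}(sec_s Z); case: (s Z).
Qed.

End Abelian.
End Extension.

Theorem theorem4p8 (K : fieldType) (A : comAlgType K) (E'' E' : plrType A)
    (abE' : plr_abelian E') (R : representation E'' E') :
  exists2 Phi : cohomology R 2 -> ext_classes R,
    bijective Phi &
    forall w : cocycle R 2,
      Phi (class_of (@cohomologous K A E'' E' R 2) w) =
      class_of (@split_equiv K A E'' E' R) (cocycle_split_ext w abE').
Proof.
apply: quotient_bijection => [e|e1 e2|e1 e2 e3|w w'|e].
- exact: ext_equiv_refl.
- exact: ext_equiv_sym.
- exact: ext_equiv_trans.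
- split=> [/cohomologous_sym /(cohomologous_curvature abE') | ww'].
    by move/(ext_equiv_cocycle_ext abE' (cocycle_split_ext w abE')).
  apply: cohomologous_sym; apply/(cohomologous_curvature abE').
  exact/(ext_equiv_cocycle_ext abE' (cocycle_split_ext w abE')).
- have [s sec_s ind_s] := split_extP e.
  have [w wE] := section_cocycle sec_s ind_s.
  by exists w; apply/ext_equiv_cocycle_ext; exists s.
Qed.
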